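(* (i) Let $0<\rho<1$ and $\theta>0$. If $$\theta\le\frac{(1-\rho)^2}{2\rho},$$ then $k=1$ maximizes $\mathrm{effar}(k;\rho,\theta)$ over integers $k\ge1$. (ii) Let $\theta>0$ and $0<\rho<1$. If $$\rho\le 1+\theta-\sqrt{\theta^2+2\theta},$$ then $k=1$ maximizes $\mathrm{effar}(k;\rho,\theta)$ over integers $k\ge1$.
   Context: For $\rho\in(-1,1)$, $\theta\ge0$ and integer $k\ge1$, define $$\mathrm{effar}(k;\rho,\theta)=\frac{1+\theta}{k+\theta}\cdot\frac{1+\rho}{1-\rho}\cdot\frac{1-\rho^k}{1+\rho^k}.$$ (This is the efficiency of thinning a Markov chain sample by factor $k$ relative to no thinning when the autocorrelations are $\rho_\ell=\rho^\ell$, advancing the chain costs $1$ and evaluating the function costs $\theta$.) *)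

(* Defs.v *)
From Stdlib Require Import Reals.
Open Scope R_scope.

(* Meaningful for -1 < rho < 1, 0 <= theta and 1 <= k, where all the
   denominators are positive. *)
Definition effar (k : nat) (rho theta : R) : R :=
  (1 + theta) / (INR k + theta)
  * ((1 + rho) / (1 - rho))
  * ((1 - rho ^ k) / (1 + rho ^ k)).

(* Main.v *)
(* Since effar 1 = 1, the claim effar k <= 1 reads
     2 theta (rho - rho^k) <= k (1 - rho) (1 + rho^k) - (1 + rho) (1 - rho^k),
   and the hypotheses of both parts amount to its case k = 2, that is
   2 theta rho <= (1 - rho)^2.  Inserting this bound on theta leaves a
   polynomial inequality in rho, proved by induction on k: its increments are
   (1 - rho) (1 - q (1 + n rho (1 - rho))) with n = k - 1 and q = rho^n, and
   they are nonnegative by a Bernoulli-type bound. *)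
Require Import Defs.
From Stdlib Require Import Reals Lra Psatz.
Open Scope R_scope.

(** The left side is 1 at [n = 0] and never increases with [n]: the factor [rho] outweighs the
    growth of the linear term. *)
Lemma pow_mul_linear_le_1 (rho : R) (n : nat) :
  0 < rho < 1 -> rho ^ n * (1 + INR n * (rho * (1 - rho))) <= 1.
Proof.
  intros Hrho.
  induction n as [|n IH]; [simpl; lra|].
  rewrite S_INR; simpl.
  apply Rle_trans with (2 := IH).
  assert (Hq : 0 < rho ^ n) by (apply pow_lt; lra).
  assert (Hc : 0 < rho * (1 - rho)) by nra.
  assert (Hn : 0 <= INR n * (rho * (1 - rho)))
    by (apply Rmult_le_pos; [apply pos_INR | lra]).
  set (c := rho * (1 - rho)) in *.
  (* Right minus left is [(1 - rho) * (1 - rho ^ 2 + INR n * c)]. *)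
  assert (Hstep : rho * (1 + INR n * c + c) <= 1 + INR n * c)
    by (unfold c in *; nra).
  nra.
Qed.

Lemma effar_polynomial_ineq (rho : R) (n : nat) :
  0 < rho < 1 ->
  (1 - rho) ^ 2 * (1 - rho ^ n) + (1 + rho) * (1 - rho * rho ^ n)
  <= (INR n + 1) * (1 - rho) * (1 + rho * rho ^ n).
Proof.
  intros Hrho.
  induction n as [|n IH]; [simpl; lra|].
  pose proof (pow_mul_linear_le_1 rho n Hrho) as Hb.
  rewrite S_INR; simpl (rho ^ S n).
  assert (Hincr : 0 <= (1 - rho)
    * (1 - rho ^ n * (1 + INR n * (rho * (1 - rho)))))
    by (apply Rmult_le_pos; lra).
  lra.
Qed.

Lemma effar_1 (rho theta : R) :
  0 < rho < 1 -> 0 < theta -> effar 1 rho theta = 1.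
Proof. intros Hrho Htheta; unfold effar; simpl; field; lra. Qed.

Lemma effar_le_effar_1 (rho theta : R) (k : nat) :
  0 < rho < 1 -> 0 < theta -> 2 * theta * rho <= (1 - rho) ^ 2 ->
  (1 <= k)%nat -> effar k rho theta <= effar 1 rho theta.
Proof.
  intros Hrho Htheta H Hk.
  rewrite effar_1 by assumption.
  destruct k as [|n]; [lia|].
  pose proof (effar_polynomial_ineq rho n Hrho) as Hpoly.
  assert (Hq : 0 < rho ^ n) by (apply pow_lt; lra).
  assert (Hq1 : rho ^ n <= 1)
    by (rewrite <- (pow1 n); apply pow_incr; lra).
  pose proof (pos_INR n) as Hn.
  unfold effar; rewrite S_INR; simpl (rho ^ S n).
  set (q := rho ^ n) in *.
  (* Once denominators are cleared, the terms in [theta] collect to [2 * theta * rho * (1 - q)], so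
     this bound and [Hpoly] add up to the goal. *)
  assert (Hmul : 2 * theta * rho * (1 - q) <= (1 - rho) ^ 2 * (1 - q))
    by (apply Rmult_le_compat_r; lra).
  assert (Hrq : 0 < rho * q) by (apply Rmult_lt_0_compat; lra).
  assert (Hden : 0 < (INR n + 1 + theta) * (1 - rho) * (1 + rho * q))
    by (repeat apply Rmult_lt_0_compat; lra).
  replace ((1 + theta) / (INR n + 1 + theta) * ((1 + rho) / (1 - rho))
           * ((1 - rho * q) / (1 + rho * q)))
    with ((1 + theta) * (1 + rho) * (1 - rho * q)
          / ((INR n + 1 + theta) * (1 - rho) * (1 + rho * q)))
    by (field; lra).
  apply Rmult_le_reg_r with (1 := Hden).
  unfold Rdiv; rewrite Rmult_assoc, Rinv_l by lra.
  lra.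
Qed.

Theorem theorem2 :
  (forall rho theta : R,
     0 < rho < 1 -> 0 < theta ->
     theta <= (1 - rho) ^ 2 / (2 * rho) ->
     forall k : nat, (1 <= k)%nat -> effar k rho theta <= effar 1 rho theta)
  /\
  (forall rho theta : R,
     0 < theta -> 0 < rho < 1 ->
     rho <= 1 + theta - sqrt (theta ^ 2 + 2 * theta) ->
     forall k : nat, (1 <= k)%nat -> effar k rho theta <= effar 1 rho theta).
Proof.
  split.
  - intros rho theta Hrho Htheta H k Hk.
    apply effar_le_effar_1; try assumption.
    apply Rmult_le_compat_r with (r := 2 * rho) in H; [|lra].
    unfold Rdiv in H; rewrite Rmult_assoc, Rinv_l in H by lra.
    lra.
  - intros rho theta Htheta Hrho H k Hk.
    apply effar_le_effar_1; try assumption.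
    pose proof (sqrt_pos (theta ^ 2 + 2 * theta)) as Hs.
    assert (Hsq : sqrt (theta ^ 2 + 2 * theta) ^ 2 = theta ^ 2 + 2 * theta)
      by (apply pow2_sqrt; nra).
    (* Expanding the square cancels [theta ^ 2 + 2 * theta] and leaves
       [2 * theta * rho <= (1 - rho) ^ 2]. *)
    assert (Hle : sqrt (theta ^ 2 + 2 * theta) ^ 2 <= (1 + theta - rho) ^ 2)
      by (apply pow_incr; lra).
    lra.
Qed.
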